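(* For all integers $N\ge 1$ and $n\ge 0$, $$\sum_{i=0}^n\binom{n}{i}\widehat E_{N,i}\widehat E_{N,n-i}=\sum_{k=0}^n\binom{n}{k}\frac{2N-k+1}{2N+1}\widehat E_{N,k}\,E_{N,n-k}.$$
   Context: For an integer $N\ge 0$, the hypergeometric Euler numbers $E_{N,n}$ are defined by $\dfrac{1}{\sum_{m\ge 0}\frac{(2N)!}{(2N+2m)!}t^{2m}}=\sum_{n=0}^\infty E_{N,n}\frac{t^n}{n!}$ (the denominator equals ${}_1F_2(1;N+1,\tfrac{2N+1}{2};\tfrac{t^2}{4})$), and the complementary hypergeometric Euler numbers $\widehat E_{N,n}$ are defined by $$\frac{t^{2N+1}/(2N+1)!}{\sinh t-\sum_{m=0}^{N-1}t^{2m+1}/(2m+1)!}=\sum_{n=0}^\infty\widehat E_{N,n}\frac{t^n}{n!},$$ equivalently $1/\sum_{m\ge0}\frac{(2N+1)!}{(2N+2m+1)!}t^{2m}=\sum_n\widehat E_{N,n}t^n/n!$. *)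

(* Defs.v *)
From HB Require Import structures.
From mathcomp Require Import all_boot all_order all_algebra.

Set Implicit Arguments.
Unset Strict Implicit.
Unset Printing Implicit Defensive.

Import Order.TTheory GRing.Theory Num.Theory.
Local Open Scope ring_scope.

(* A formal power series over the rationals is its sequence of coefficients:
   [f : fps] stands for \sum_n f n t^n. *)
Definition fps := nat -> rat.

Definition fps_monom (k : nat) : fps := fun n => (n == k)%:R.

Definition fps_mul (f g : fps) : fps :=
  fun n => \sum_(k < n.+1) f k * g (n - k)%N.

Definition fps_next (d : nat) (f g : fps) (s : seq rat) : rat :=
  (f (size s + d)%N - \sum_(k < size s) s`_k * g (size s - k + d)%N) / g d.

(* The quotient f / g when g has order exactly d and f has order at least d;
   t^d is cancelled before dividing.  See [fps_divK] and [fps_div_uniq]. *)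
Definition fps_div (d : nat) (f g : fps) : fps :=
  fun n => (iter n.+1 (fun s => rcons s (fps_next d f g s)) [::])`_n.

Definition egf (a : nat -> rat) : fps := fun n => a n / n`!%:R.

Definition egf_coef (f : fps) : nat -> rat := fun n => f n * n`!%:R.

(* \sum_(m >= 0) (2N)! / (2N + 2m)! t^(2m), indexed by n = 2m *)
Definition euler_den (N : nat) : fps :=
  fun n => if odd n then 0 else (2 * N)`!%:R / (2 * N + n)`!%:R.

Definition hypEuler (N : nat) : nat -> rat :=
  egf_coef (fps_div 0 (fps_monom 0) (euler_den N)).

Definition fps_sinh : fps := fun n => if odd n then (n`!%:R)^-1 else 0.

Definition sinh_tail (N : nat) : fps :=
  fun n => fps_sinh n
           - \sum_(m < N) fps_monom (2 * m).+1 n / ((2 * m).+1)`!%:R.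

Definition chypEuler_num (N : nat) : fps :=
  fun n => fps_monom (2 * N).+1 n / ((2 * N).+1)`!%:R.

Definition chypEuler (N : nat) : nat -> rat :=
  egf_coef (fps_div (2 * N).+1 (chypEuler_num N) (sinh_tail N)).

Section Division.
Variables (d : nat) (f g : fps).

Let st n := iter n (fun s => rcons s (fps_next d f g s)) [::].

Let size_st n : size (st n) = n.
Proof. by elim: n => //= n IH; rewrite size_rcons IH. Qed.

Let nth_st n k : (k < n)%N -> (st n)`_k = fps_div d f g k.
Proof.
elim: n => // n IH; rewrite ltnS leq_eqVlt => /predU1P[->//|lt_kn].
by rewrite /= nth_rcons size_st lt_kn IH.
Qed.

Lemma fps_divE n :
  fps_div d f g n =
  (f (n + d)%N - \sum_(k < n) fps_div d f g k * g (n - k + d)%N) / g d.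
Proof.
rewrite {1}/fps_div /= -/(st n) nth_rcons size_st ltnn eqxx /fps_next size_st.
by congr ((_ - _) / _); apply: eq_bigr => k _; rewrite nth_st.
Qed.

Hypothesis g_small : forall i, (i < d)%N -> g i = 0.

Let mul_shift (q : fps) n :
  fps_mul q g (n + d)%N = \sum_(k < n) q k * g (n - k + d)%N + q n * g d.
Proof.
rewrite /fps_mul -(big_mkord xpredT (fun k => q k * g (n + d - k)%N)).
rewrite (big_cat_nat (n := n.+1)) //=; last by rewrite ltnS leq_addr.
rewrite [X in _ + X]big1_seq ?addr0 => [|k].
  rewrite big_nat_recr //= addKn big_mkord; congr (_ + _).
  by apply: eq_bigr => k _; rewrite addnBAC // ltnW.
rewrite mem_index_iota => /andP[_ /andP[nk kd]].
by rewrite g_small ?mulr0 // ltn_subLR // ltn_add2r.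
Qed.

Hypothesis g_d : g d != 0.

Lemma fps_divK :
  (forall i, (i < d)%N -> f i = 0) -> fps_mul (fps_div d f g) g =1 f.
Proof.
move=> f_small n; have [lt_nd|le_dn] := ltnP n d.
  rewrite f_small // /fps_mul big1 // => k _.
  by rewrite g_small ?mulr0 // (leq_ltn_trans (leq_subr _ _)).
by rewrite -(subnK le_dn) mul_shift fps_divE divfK // subrKC.
Qed.

Lemma fps_div_uniq (q : fps) : fps_mul q g =1 f -> q =1 fps_div d f g.
Proof.
move=> qg n; elim/ltn_ind: n => n IH; rewrite fps_divE -qg mul_shift.
apply: (canRL (mulfK g_d)); apply: (canRL (addrK _)).
by rewrite addrC; congr (_ + _); apply: eq_bigr => k _; rewrite IH.
Qed.

End Division.

Lemma egf_coefK f : egf (egf_coef f) =1 f.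
Proof. by move=> n; rewrite /egf /egf_coef mulfK // pnatr_eq0 -lt0n fact_gt0. Qed.

Lemma hypEuler_gf N : fps_mul (egf (hypEuler N)) (euler_den N) =1 fps_monom 0.
Proof.
move=> n; rewrite -[RHS](fps_divK (d := 0) (g := euler_den N)) //.
  by apply: eq_bigr => k _; rewrite egf_coefK.
by rewrite /euler_den /= addn0 divff ?oner_eq0 // pnatr_eq0 -lt0n fact_gt0.
Qed.

Lemma sinh_tailE N n :
  sinh_tail N n = if odd n && (2 * N < n)%N then (n`!%:R)^-1 else 0.
Proof.
rewrite /sinh_tail /fps_sinh /fps_monom; case: ifP => [odd_n|even_n] /=.
  have -> : n = (2 * n./2).+1 by rewrite -[LHS]odd_double_half odd_n mul2n.
  rewrite ltnS leq_pmul2l //; have [le_Nn|lt_nN] := leqP N n./2.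
    rewrite big1 ?subr0 // => m _; rewrite eqSS eqn_pmul2l //.
    by rewrite gtn_eqF ?mul0r // (leq_trans (ltn_ord m)).
  rewrite (bigD1 (Ordinal lt_nN)) //= eqxx mul1r big1 ?addr0 ?subrr // => m.
  rewrite -val_eqE /= eq_sym => /negPf ne.
  by rewrite eqSS eqn_pmul2l // ne mul0r.
rewrite big1 ?subrr // => m _; case: eqP => [e|_]; last by rewrite mul0r.
by rewrite e /= oddM in even_n.
Qed.

Lemma chypEuler_gf N :
  fps_mul (egf (chypEuler N)) (sinh_tail N) =1 chypEuler_num N.
Proof.
move=> n; rewrite -[RHS](fps_divK (d := (2 * N).+1) (g := sinh_tail N)).
- by apply: eq_bigr => k _; rewrite egf_coefK.
- by move=> i; rewrite ltnS sinh_tailE ltnNge => ->; rewrite andbF.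
- by rewrite sinh_tailE ltnSn /= oddM /= invr_eq0 pnatr_eq0 -lt0n fact_gt0.
- by move=> i lti; rewrite /chypEuler_num /fps_monom ltn_eqF ?mul0r.
Qed.

(* Main.v *)
(** Put [F = \sum_n chypEuler N n t^n / n!], [S = sinh_tail N],
    [T = t^(2N+1) / (2N+1)!], [D = euler_den N], [H = 1 / D] and
    [theta = t d/dt].  Applying [theta] to [F S = T] gives
    [(F - theta F / (2N+1)) S = F (theta S) / (2N+1)], and the right-hand side
    is [F T D] because differentiating the tail of sinh gives the tail of cosh.
    Multiplying by [F H] yields [(F - theta F / (2N+1)) H T = F F T], and [T] can
    be cancelled. *)
Require Import Defs.
From HB Require Import structures.
From mathcomp Require Import all_boot all_order all_algebra.
From mathcomp Require Import ring.

Set Implicit Arguments.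
Unset Strict Implicit.
Unset Printing Implicit Defensive.

Import Order.TTheory GRing.Theory Num.Theory.
Local Open Scope ring_scope.

Lemma natr_fact_neq0 n : n`!%:R != 0 :> rat.
Proof. by rewrite pnatr_eq0 -lt0n fact_gt0. Qed.

(** The coefficient at [n] involves only indices up to [n], so truncation below any [m > n] loses
    nothing; commutativity and associativity then come from [{poly rat}]. *)
Lemma fps_mul_poly m (f g : fps) n : (n < m)%N ->
  fps_mul f g n = ((\poly_(i < m) f i) * (\poly_(i < m) g i))`_n.
Proof.
move=> lt_nm; rewrite coefM; apply: eq_bigr => k _; rewrite !coef_poly.
have -> : (k < m)%N by apply: leq_ltn_trans lt_nm; rewrite -ltnS.
by rewrite (leq_ltn_trans (leq_subr _ _) lt_nm).
Qed.

Lemma eq_fps_mul (f f' g g' : fps) :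
  f =1 f' -> g =1 g' -> fps_mul f g =1 fps_mul f' g'.
Proof. by move=> ff gg n; apply: eq_bigr => k _; rewrite ff gg. Qed.

Lemma fps_mulC (f g : fps) : fps_mul f g =1 fps_mul g f.
Proof. by move=> n; rewrite !(@fps_mul_poly n.+1) // mulrC. Qed.

Lemma fps_mulA (f g h : fps) :
  fps_mul f (fps_mul g h) =1 fps_mul (fps_mul f g) h.
Proof.
move=> n; pose P (u : fps) := \poly_(i < n.+1) u i.
transitivity ((P f * (P g * P h))`_n); last rewrite mulrA.
  rewrite coefM; apply: eq_bigr => k _; rewrite coef_poly ltn_ord.
  by rewrite (@fps_mul_poly n.+1) // ltnS leq_subr.
rewrite coefM; apply: eq_bigr => k _; rewrite [(P h)`_ _]coef_poly.
by rewrite ltnS leq_subr (@fps_mul_poly n.+1).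
Qed.

Lemma fps_mul_monom d (u : fps) c n :
  fps_mul u (fun i => fps_monom d i / c) (n + d)%N = u n / c.
Proof.
have lt_n : (n < (n + d).+1)%N by rewrite ltnS leq_addr.
rewrite /fps_mul (bigD1 (Ordinal lt_n)) //= addKn /fps_monom eqxx mul1r.
rewrite big1 ?addr0 // => k; rewrite -val_eqE /= => ne_kn.
have -> : (n + d - k == d)%N = false; last by rewrite mul0r mulr0.
apply: contraNF ne_kn => /eqP e; have le_k : (k <= n + d)%N by rewrite -ltnS.
by have := subnKC le_k; rewrite e => /addIn ->.
Qed.

Lemma fps_mul1 (u : fps) : fps_mul u (fps_monom 0) =1 u.
Proof.
move=> n; have := fps_mul_monom 0 u 1 n; rewrite addn0 divr1 => <-.
by apply: eq_fps_mul => // i; rewrite divr1.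
Qed.

Lemma fps_mul_monom_small d (u : fps) c n : (n < d)%N ->
  fps_mul u (fun i => fps_monom d i / c) n = 0.
Proof.
move=> lt_nd; rewrite /fps_mul big1 // => k _; rewrite /fps_monom.
by rewrite ltn_eqF ?mul0r ?mulr0 // (leq_ltn_trans (leq_subr _ _)).
Qed.

Definition fps_theta (f : fps) : fps := fun n => n%:R * f n.

(** Leibniz rule: the weight splits as [n = k + (n - k)] in each term. *)
Lemma fps_thetaM (f g : fps) n :
  fps_theta (fps_mul f g) n
  = fps_mul (fps_theta f) g n + fps_mul f (fps_theta g) n.
Proof.
rewrite /fps_theta /fps_mul mulr_sumr -big_split; apply: eq_bigr => k _ /=.
have le_kn : (k <= n)%N by rewrite -ltnS.
by rewrite -{1}(subnKC le_kn) natrD; ring.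
Qed.

Lemma fps_mul_egf (a b : nat -> rat) n :
  \sum_(0 <= i < n.+1) 'C(n, i)%:R * a i * b (n - i)%N
  = n`!%:R * fps_mul (egf a) (egf b) n.
Proof.
rewrite big_mkord /fps_mul mulr_sumr; apply: eq_bigr => k _.
have le_kn : (k <= n)%N by rewrite -ltnS.
rewrite /egf -(bin_fact le_kn) !natrM.
by field; rewrite !natr_fact_neq0.
Qed.

(** For [n = m + 2N + 1] with [m] even, both sides equal [1 / (2N + m)!]: the weight [n] turns
    [1 / n!] into [1 / (n - 1)!], a coefficient of the cosh tail shifted by one. *)
Lemma theta_sinh_tail N n :
  fps_theta (sinh_tail N) n
  = (2 * N).+1%:R * fps_mul (euler_den N) (chypEuler_num N) n.
Proof.
rewrite /fps_theta sinh_tailE; have [lt_n|le_n] := ltnP n (2 * N).+1.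
  by rewrite fps_mul_monom_small // andbF !mulr0.
rewrite -(subnK le_n); move: (n - _)%N => m; rewrite fps_mul_monom /euler_den.
rewrite oddD /= oddM /= addbT andbT.
case: (odd m) => /=; first by rewrite mul0r !mulr0.
rewrite addnC addSn !factS !natrM.
have := natr_fact_neq0 (2 * N); have := natr_fact_neq0 (2 * N + m).
have : (2 * N).+1%:R != 0 :> rat by rewrite pnatr_eq0.
have : (2 * N + m).+1%:R != 0 :> rat by rewrite pnatr_eq0.
(* The successors and factorials become opaque atoms for [field]. *)
move: _.+1%:R _`!%:R _.+1%:R _`!%:R => p pf q qf p0 q0 pf0 qf0.
by field; rewrite p0 q0 pf0 qf0.
Qed.

Theorem theorem6 (N n : nat) (hN : (1 <= N)%N) :
  \sum_(0 <= i < n.+1) 'C(n, i)%:R * chypEuler N i * chypEuler N (n - i)%N =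
  \sum_(0 <= k < n.+1)
     'C(n, k)%:R * (((2 * N)%:R - k%:R + 1) / (2 * N + 1)%:R)
       * chypEuler N k * hypEuler N (n - k)%N.
Proof.
pose d := (2 * N).+1; have d0 : d%:R != 0 :> rat by rewrite pnatr_eq0.
(* The weight is absorbed into one factor, so that both sides become binomial convolutions, that is,
   products of exponential generating functions. *)
pose a k := ((2 * N)%:R - k%:R + 1) / (2 * N + 1)%:R * chypEuler N k.
under [RHS]eq_bigr => k _ do rewrite -[_ * _ * chypEuler N k]mulrA -/(a k).
rewrite !fps_mul_egf; congr (_ * _).
set F := egf (chypEuler N); set H := egf (hypEuler N); set A := egf a.
pose S := sinh_tail N; pose T := chypEuler_num N; pose D := euler_den N.
have FS : fps_mul F S =1 T := chypEuler_gf N.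
have HD : fps_mul H D =1 fps_monom 0 := hypEuler_gf N.
have thetaT i : fps_theta T i = d%:R * T i.
  rewrite /fps_theta /T /chypEuler_num /fps_monom.
  by case: eqP => [->|_] //; rewrite mul0r !mulr0.
(* With [d = 2N + 1] the weight is [(d - k) / d = 1 - k / d]. *)
have AE k : A k = F k - d%:R^-1 * fps_theta F k.
  rewrite /A /F /fps_theta /egf /a addn1 -/d.
  have -> : (2 * N)%:R = d%:R - 1 :> rat by rewrite /d -natr1 addrK.
  by field; rewrite d0 natr_fact_neq0.
have AS : fps_mul A S =1 fps_mul F (fps_mul D T).
  move=> i; have := fps_thetaM F S i.
  have -> : fps_theta (fps_mul F S) i = d%:R * fps_mul F S i.
    by rewrite /fps_theta !FS; apply: thetaT.
  have -> : fps_mul F (fps_theta S) i = d%:R * fps_mul F (fps_mul D T) i.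
    rewrite /fps_mul mulr_sumr; apply: eq_bigr => k _.
    by rewrite theta_sinh_tail mulrCA.
  have -> : fps_mul A S i = fps_mul F S i - d%:R^-1 * fps_mul (fps_theta F) S i.
    rewrite /fps_mul mulr_sumr -sumrB; apply: eq_bigr => k _.
    by rewrite AE mulrBl [in RHS]mulrA.
  move=> e; apply: (mulfI d0); rewrite mulrBr mulVKf // e; ring.
(* [T] is replaced by [F S], and [A S] by [F D T], so no division by [S] is needed. *)
have AT : fps_mul A T =1 fps_mul (fps_mul (fps_mul F F) T) D.
  move=> i; rewrite -(eq_fps_mul (frefl A) FS).
  rewrite (eq_fps_mul (frefl A) (fps_mulC F S)) fps_mulA.
  rewrite (eq_fps_mul AS (frefl F)) fps_mulC fps_mulA.
  by rewrite (eq_fps_mul (frefl _) (fps_mulC D T)) fps_mulA.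
have AHT i : fps_mul (fps_mul A H) T i = fps_mul (fps_mul F F) T i.
  rewrite -fps_mulA (eq_fps_mul (frefl A) (fps_mulC H T)) fps_mulA.
  rewrite (eq_fps_mul AT (frefl H)) -fps_mulA.
  rewrite (eq_fps_mul (frefl _) (fps_mulC D H)).
  by rewrite (eq_fps_mul (frefl _) HD) fps_mul1.
(* Multiplication by [T] shifts indices by [d] and divides by [d!], so index [n + d] recovers
   coefficient [n] of both products. *)
have := AHT (n + d)%N; rewrite !fps_mul_monom => e.
by apply/esym/(mulIf _ e); rewrite invr_eq0 natr_fact_neq0.
Qed.
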